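(* Let $L$ be a finite-dimensional 3-step nilpotent Lie superalgebra over a field $\mathbb{F}$. Then there exists a non-trivial superderivation $D\in\operatorname{Der}(L)$ of $L$ such that $D(L^1)\subseteq Z(L)$. Furthermore, $L$ admits pure local superderivations, i.e. there exists a local superderivation of $L$ that is not a superderivation of $L$.
   Context: A Lie superalgebra over $\mathbb{F}$ is a $\mathbb{Z}_2$-graded vector space $L=L_{\bar 0}\oplus L_{\bar 1}$ with a bilinear bracket satisfying $[L_\alpha,L_\beta]\subseteq L_{\alpha+\beta}$ and, for all $x\in L_\alpha$, $y\in L_\beta$, $z\in L$ with $\alpha,\beta\in\mathbb{Z}_2$ (in the first identity $x,y$ are homogeneous of degrees $|x|=\alpha$, $|y|=\beta$), $[x,y]=-(-1)^{|x||y|}[y,x]$ and $[x,[y,z]]=[[x,y],z]+(-1)^{|x||y|}[y,[x,z]]$. Lower central series: $L^0=L$, $L^1=[L,L]$, $L^k=[L,L^{k-1}]$ for $k\geq 1$. $L$ is nilpotent if $L^n=0$ for some positive integer $n$; the smallest such positive integer $n$ is the nilpotency index, and $L$ is then called $n$-step nilpotent. (So 3-step nilpotent means $L^2\neq 0$ and $L^3=0$.) The center is $Z(L)=\{x\in L\mid [x,y]=0 \text{ for all } y\in L\}$. A linear map $D:L\to L$ that is homogeneous of degree $|D|=\alpha\in\mathbb{Z}_2$ (i.e. $D(L_\beta)\subseteq L_{\alpha+\beta}$) is a superderivation of degree $\alpha$ if $D([x,y])=[D(x),y]+(-1)^{|D||x|}[x,D(y)]$ for all homogeneous $x\in L$ and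 all $y\in L$. Let $\operatorname{Der}_\alpha(L)$ be the set of these, and $\operatorname{Der}(L)=\operatorname{Der}_{\bar 0}(L)\oplus\operatorname{Der}_{\bar 1}(L)$; the elements of $\operatorname{Der}(L)$ are the superderivations of $L$. A superderivation $D$ is trivial if $D(x)=0$ for all $x\in L$, and non-trivial otherwise. A linear map $\Delta:L\to L$ is a local superderivation if for every $x\in L$ there is a superderivation $D_x\in\operatorname{Der}(L)$ (depending on $x$) with $\Delta(x)=D_x(x)$. A pure local superderivation is a local superderivation that is not a superderivation. *)

(* Defs.v *)
From HB Require Import structures.
From mathcomp Require Import all_boot all_order all_algebra.

Set Implicit Arguments.
Unset Strict Implicit.
Unset Printing Implicit Defensive.

Import GRing.Theory.

Local Open Scope ring_scope.

(* Finite-dimensional Lie superalgebras: finite dimension is built into the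
   carrier, a [vectType F].  In the signs, the product [a * b] of degrees is
   the product in [nat] of their representatives in {0, 1}. *)
Record lieSuperalgebra (F : fieldType) := LieSuperalgebra {
  superspace :> vectType F;
  grade : 'Z_2 -> {vspace superspace};
  grade_sum : (grade 0%R + grade 1%R)%VS = fullv;
  grade_direct : directv (grade 0%R + grade 1%R);
  bracket : {bilinear superspace -> superspace -> superspace};
  bracket_grade : forall (a b : 'Z_2) (x y : superspace),
    x \in grade a -> y \in grade b -> bracket x y \in grade (a + b);
  bracket_skew : forall (a b : 'Z_2) (x y : superspace),
    x \in grade a -> y \in grade b ->
    bracket x y = - ((-1) ^+ (a * b) *: bracket y x);
  bracket_jacobi : forall (a b : 'Z_2) (x y z : superspace),
    x \in grade a -> y \in grade b ->
    bracket x (bracket y z) =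
      bracket (bracket x y) z + (-1) ^+ (a * b) *: bracket y (bracket x z)
}.

Section LieSuperalgebraTheory.

Variables (F : fieldType) (L : lieSuperalgebra F).
Implicit Types (U V W : {vspace L}) (x y : L) (D Delta : 'End(L)).

(* The span of all brackets [u, v] with u in U and v in V (see [bracketvP]),
   built from bases as [prodv] is for algebras. *)
Definition bracketv U V : {vspace L} :=
  <<[seq bracket L u v | u <- vbasis U, v <- vbasis V]>>%VS.

Lemma memv_bracket U V x y :
  x \in U -> y \in V -> bracket L x y \in bracketv U V.
Proof.
move=> /coord_vbasis-> /coord_vbasis->.
rewrite linear_sumlz; apply: memv_suml => i _.
rewrite linear_sumr; apply: memv_suml => j _.
rewrite linearZl_LR linearZr_LR !memvZ // memv_span //.
by apply: allpairs_f; rewrite mem_nth ?size_tuple.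
Qed.

Lemma bracketvP U V W :
  reflect (forall x y, x \in U -> y \in V -> bracket L x y \in W)
          (bracketv U V <= W)%VS.
Proof.
apply: (iffP idP) => [/subvP sUVW x y Ux Vy | sUVW].
  by rewrite sUVW ?memv_bracket.
apply/span_subvP=> _ /allpairsP[[u v] /= [Uu Vv ->]].
by rewrite sUVW ?vbasis_mem.
Qed.

Fixpoint lower_central (k : nat) : {vspace L} :=
  if k is k'.+1 then bracketv fullv (lower_central k') else fullv.

Definition step_nilpotent (n : nat) : Prop :=
  [/\ (0 < n)%N, lower_central n = 0%VS
    & forall m : nat, (0 < m < n)%N -> lower_central m <> 0%VS].

Definition in_center x : Prop := forall y, bracket L x y = 0.

Definition homogeneous_superderivation (a : 'Z_2) D : Prop :=
  (forall (b : 'Z_2) x, x \in grade L b -> D x \in grade L (a + b)) /\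
  (forall (b : 'Z_2) x y, x \in grade L b ->
     D (bracket L x y) =
       bracket L (D x) y + (-1) ^+ (a * b) *: bracket L x (D y)).

Definition superderivation D : Prop :=
  exists D0 D1 : 'End(L),
    [/\ homogeneous_superderivation 0 D0,
        homogeneous_superderivation 1 D1 & D = D0 + D1].

Definition trivial_superderivation D : Prop := forall x, D x = 0.

Definition local_superderivation Delta : Prop :=
  forall x, exists D, superderivation D /\ Delta x = D x.

Definition pure_local_superderivation Delta : Prop :=
  local_superderivation Delta /\ ~ superderivation Delta.

End LieSuperalgebraTheory.

Arguments lower_central {F} L k.
Arguments step_nilpotent {F} L n.

(* Main.v *)
Require Import Defs.
From HB Require Import structures.
From mathcomp Require Import all_boot all_order all_algebra.

Set Implicit Arguments.
Unset Strict Implicit.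
Unset Printing Implicit Defensive.

(* Since L^2 <> 0, some [ad a] does not vanish on L^1, and it maps L^1 into L^2,
   which is central because L^3 = 0.  Let Delta be [ad a] on L^1 and 0 on a
   complement of L^1.  On L^1, Delta agrees with the superderivation [ad a];
   at x outside L^1, some linear map L / L^1 -> Z(L) has the value Delta(x),
   and the homogeneous parts of such a map are superderivations.  But a
   superderivation with central values kills L^1, and Delta does not. *)

Import GRing.Theory.
Local Open Scope ring_scope.

(** * Degrees in Z/2 and linear functionals *)

Lemma Z2P (a : 'Z_2) : a = 0 \/ a = 1.
Proof. by case: a => [[|[|m]] lt_m] //; [left|right]; apply: val_inj. Qed.

Lemma addr11_Z2 : 1 + 1 = 0 :> 'Z_2.
Proof. exact: val_inj. Qed.

(** The map u - [projv U u] is linear, kills U and sends x to some e <> 0; f is a coordinate of it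
    that is nonzero at e, divided by its value there. *)
Lemma exists_scalar_annihilating (F : fieldType) (V : vectType F)
    (U : {vspace V}) (x : V) :
  x \notin U -> exists f : V -> F,
    [/\ scalar f, f x = 1 & forall u, u \in U -> f u = 0].
Proof.
set e := x - projv U x => xNU.
have e_neq0 : e != 0.
  by apply: contra xNU; rewrite subr_eq0 => /eqP->; apply: memv_proj.
have [i ei_neq0] : exists i, coord (vbasis fullv) i e != 0.
  apply/existsP; rewrite -negb_forall; apply: contra e_neq0 => /forallP e0.
  rewrite (coord_vbasis (memvf e)) big1 // => i _.
  by rewrite (eqP (e0 i)) scale0r.
exists (fun u => coord (vbasis fullv) i (u - projv U u)
                   / coord (vbasis fullv) i e).
split=> [c u v | | u Uu]; last by rewrite projv_id // subrr linear0 mul0r.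
- rewrite linearP opprD addrACA -scalerBr linearP mulrDl.
  by rewrite -mulrA.
- by rewrite divff.
Qed.

Section Superderivations.

Variables (F : fieldType) (L : lieSuperalgebra F).
Implicit Types (x y z : L) (D : 'End(L)) (a b : 'Z_2).

(** * Homogeneous components; the center and L^1 are graded subspaces *)

Lemma grade_decomp a x :
  exists x0 x1, [/\ x0 \in grade L a, x1 \in grade L (a + 1) & x = x0 + x1].
Proof.
have /memv_addP[x0 Lx0 [x1 Lx1 ->]] : x \in (grade L 0%R + grade L 1%R)%VS.
  by rewrite grade_sum memvf.
case: (Z2P a) => ->; first by exists x0, x1; rewrite add0r.
by exists x1, x0; rewrite addr11_Z2 addrC.
Qed.

Lemma grade_addr_eq0 a x y :
  x \in grade L a -> y \in grade L (a + 1) -> x + y = 0 -> x = 0 /\ y = 0.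
Proof.
move=> Lx Ly xy0; suffices x0 : x = 0 by move: xy0; rewrite x0 add0r.
have Lx1 : x \in grade L (a + 1).
  by move/eqP: xy0; rewrite addr_eq0 => /eqP->; rewrite memvN.
apply/eqP; rewrite -memv0 -(directv_addP (grade_direct L)) memv_cap.
case: (Z2P a) Lx Lx1 => -> Lx; first by rewrite add0r => Lx1; apply/andP.
by rewrite addr11_Z2 => Lx0; apply/andP.
Qed.

Lemma grade_bracket_eq0 x :
  (forall b y, y \in grade L b -> bracket L x y = 0) -> in_center x.
Proof.
move=> x0 y; have [y0 [y1 [Ly0 Ly1 ->]]] := grade_decomp 0 y.
by rewrite linearDr /= (x0 _ _ Ly0) (x0 _ _ Ly1) addr0.
Qed.

(** Against z homogeneous of degree b, the brackets [x, z] and [y, z] have the distinct degrees a +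
    b and a + b + 1, so they can only cancel if both vanish. *)
Lemma center_grade a x y :
    x \in grade L a -> y \in grade L (a + 1) -> in_center (x + y) ->
  in_center x /\ in_center y.
Proof.
move=> Lx Ly Zxy.
have xy0 b z : z \in grade L b -> bracket L x z = 0 /\ bracket L y z = 0.
  move=> Lz; apply: (@grade_addr_eq0 (a + b)); first exact: bracket_grade.
    by rewrite addrAC; apply: bracket_grade.
  by rewrite -linearDl; apply: Zxy.
by split; apply: grade_bracket_eq0 => b z /xy0[].
Qed.

(** The sign in skew-symmetry depends on the degrees, so sides can be exchanged only after splitting
    into homogeneous components, each of which is annihilated separately. *)
Lemma right_center x : (forall y, bracket L y x = 0) -> in_center x.
Proof.
have [x0 [x1 [Lx0 Lx1 ->]]] := grade_decomp 0 x => Zx y.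
apply: grade_bracket_eq0 y => b y Ly.
have [yx0 yx1] : bracket L y x0 = 0 /\ bracket L y x1 = 0.
  apply: (@grade_addr_eq0 b); first by rewrite -[b]addr0; apply: bracket_grade.
    by rewrite -[1]add0r; apply: bracket_grade.
  by rewrite -linearDr.
rewrite linearDl /= (bracket_skew Lx0 Ly) (bracket_skew Lx1 Ly) yx0 yx1.
by rewrite !scaler0 oppr0 addr0.
Qed.

Lemma center_right x y : in_center x -> bracket L y x = 0.
Proof.
have [x0 [x1 [Lx0 Lx1 ->]]] := grade_decomp 0 x.
have [y0 [y1 [Ly0 Ly1 ->]]] := grade_decomp 0 y.
case/(center_grade Lx0 Lx1) => Zx0 Zx1; rewrite linearDl /= !linearDr /=.
rewrite (bracket_skew Ly0 Lx0) (bracket_skew Ly0 Lx1).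
rewrite (bracket_skew Ly1 Lx0) (bracket_skew Ly1 Lx1).
by rewrite !Zx0 !Zx1 !scaler0 !oppr0 !addr0.
Qed.

(** L^1 is spanned by brackets of homogeneous elements, hence is the sum of its intersections [G b]
    with the two grades; uniqueness of components does the rest. *)
Lemma derived_grade a x0 x1 :
    x0 \in grade L a -> x1 \in grade L (a + 1) ->
    x0 + x1 \in lower_central L 1 ->
  x0 \in lower_central L 1.
Proof.
pose G b := (lower_central L 1 :&: grade L b)%VS.
have sG : (lower_central L 1 <= G 0%R + G 1%R)%VS.
  have Gx b x : x \in G b -> x \in (G 0%R + G 1%R)%VS.
    by case: (Z2P b) => ->; apply/subvP; rewrite ?addvSl ?addvSr.
  have Gbr b c x y : x \in grade L b -> y \in grade L c ->
      bracket L x y \in (G 0%R + G 1%R)%VS.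
    move=> Lx Ly; apply: (Gx (b + c)).
    by rewrite memv_cap bracket_grade // memv_bracket ?memvf.
  apply/bracketvP=> x y _ _.
  have [u0 [u1 [Lu0 Lu1 ->]]] := grade_decomp 0 x.
  have [v0 [v1 [Lv0 Lv1 ->]]] := grade_decomp 0 y.
  rewrite linearDl /= !linearDr /= !memvD //.
  - exact: Gbr Lu0 Lv0.
  - exact: Gbr Lu0 Lv1.
  - exact: Gbr Lu1 Lv0.
  - exact: Gbr Lu1 Lv1.
have {}sG : (lower_central L 1 <= G a + G (a + 1)%R)%VS.
  by case: (Z2P a) => ->; rewrite ?add0r // addr11_Z2 addvC.
move=> Lx0 Lx1 /(subvP sG) /memv_addP[w0 + [w1 +]].
rewrite !memv_cap => /andP[L1w0 Lw0] /andP[_ Lw1] Dx.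
suffices -> : x0 = w0 by [].
apply/eqP; rewrite -subr_eq0; apply/eqP.
have [] // := @grade_addr_eq0 a (x0 - w0) (x1 - w1); rewrite ?memvB //.
by rewrite addrACA -opprD Dx subrr.
Qed.

(** * Superderivations: sums, inner ones, and those with central values *)

Lemma superderivation_homogeneous a D :
  homogeneous_superderivation a D -> superderivation D.
Proof.
have hom0 b : homogeneous_superderivation b (0 : 'End(L)).
  split=> [c x _ | c x y _]; rewrite !lfunE /= ?mem0v //.
  by rewrite linear0l linear0r scaler0 addr0.
by case: (Z2P a) => -> dD; [exists D, 0 | exists 0, D];
  rewrite ?addr0 ?add0r; split.
Qed.

Lemma homogeneous_superderivationD a D1 D2 :
    homogeneous_superderivation a D1 -> homogeneous_superderivation a D2 ->
  homogeneous_superderivation a (D1 + D2).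
Proof.
move=> [gD1 dD1] [gD2 dD2]; split=> [b x Lx | b x y Lx].
  by rewrite lfunE memvD ?gD1 ?gD2.
rewrite !lfunE /= (dD1 b) // (dD2 b) // linearDl linearDr /= scalerDr.
by rewrite addrACA.
Qed.

Lemma superderivationD D1 D2 :
  superderivation D1 -> superderivation D2 -> superderivation (D1 + D2).
Proof.
move=> [A0 [A1 [dA0 dA1 ->]]] [B0 [B1 [dB0 dB1 ->]]].
exists (A0 + B0), (A1 + B1); rewrite addrACA.
by split=> //; apply: homogeneous_superderivationD.
Qed.

Definition ad x : 'End(L) := linfun (bracket L x).

(** For homogeneous x the Jacobi identity is the derivation rule of [ad x], in the degree of x. *)
Lemma superderivation_ad x : superderivation (ad x).
Proof.
have [x0 [x1 [Lx0 Lx1 ->]]] := grade_decomp 0 x.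
have hom_ad a y : y \in grade L a -> homogeneous_superderivation a (ad y).
  move=> Ly; split=> [b u Lu | b u v Lu]; rewrite !lfunE /=.
    exact: bracket_grade.
  exact: bracket_jacobi.
have -> : ad (x0 + x1) = ad x0 + ad x1.
  by apply/lfunP=> y; rewrite !lfunE /= !lfunE /= linearDl.
have /superderivation_homogeneous dx0 := hom_ad _ _ Lx0.
have /superderivation_homogeneous dx1 := hom_ad _ _ Lx1.
exact: superderivationD.
Qed.

(** The derivation rule writes the image of a bracket as a sum of brackets with a central entry. The
    rule concerns [D0] and [D1] separately; their values are central too, since on homogeneous x
    they are the two components of the central element D x. *)
Lemma superderivation_central D :
    superderivation D -> (forall x, in_center (D x)) ->
  forall x, x \in lower_central L 1 -> D x = 0.
Proof.
move=> [D0 [D1 [[gD0 dD0] [gD1 dD1] ->]]] ZD.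
have ZDb b x : x \in grade L b -> in_center (D0 x) /\ in_center (D1 x).
  move=> Lx; apply: (@center_grade b); last first.
  - by have := ZD x; rewrite lfunE.
  - by rewrite addrC; apply: gD1.
  - by rewrite -[b]add0r; apply: gD0.
have {}ZDb x : in_center (D0 x) /\ in_center (D1 x).
  have [x0 [x1 [Lx0 Lx1 ->]]] := grade_decomp 0 x.
  have [Z00 Z10] := ZDb _ _ Lx0; have [Z01 Z11] := ZDb _ _ Lx1.
  by split=> y; rewrite linearD linearDl /= ?Z00 ?Z01 ?Z10 ?Z11 addr0.
have D_br b x y : x \in grade L b -> (D0 + D1) (bracket L x y) = 0.
  move=> Lx; have [ZD0x ZD1x] := ZDb x; have [ZD0y ZD1y] := ZDb y.
  rewrite lfunE /= (dD0 _ _ _ Lx) (dD1 _ _ _ Lx) ZD0x ZD1x.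
  by rewrite !center_right // !scaler0 !addr0.
have sker : (lower_central L 1 <= lker (D0 + D1)%R)%VS.
  apply/bracketvP=> x y _ _; rewrite memv_ker; apply/eqP.
  have [x0 [x1 [Lx0 Lx1 ->]]] := grade_decomp 0 x.
  by rewrite linearDl linearD /= (D_br _ _ _ Lx0) (D_br _ _ _ Lx1) addr0.
by move=> x /(subvP sker); rewrite memv_ker => /eqP.
Qed.

(** A map u |-> f u *: z with f vanishing on L^1 and z central satisfies the derivation rule
    trivially, all terms being 0. The work lies in choosing f so that the homogeneous components of
    z give homogeneous maps. *)
Lemma superderivation_interpolate x z :
    x \notin lower_central L 1 -> in_center z ->
  exists D, superderivation D /\ D x = z.
Proof.
have [x0 [x1 [Lx0 Lx1 ->]]] := grade_decomp 0 x => L1x.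
(* L^1 is a subspace, so one of the components of x lies outside it; its degree is called a. *)
have {x0 x1 Lx0 Lx1 L1x} [a [xa [xb [-> Lxa Lxb L1xa]]]] :
    exists a xa xb, [/\ x0 + x1 = xa + xb, xa \in grade L a,
      xb \in grade L (a + 1) & xa \notin lower_central L 1].
  have [L1x0|L1x0] := boolP (x0 \in lower_central L 1); last first.
    by exists 0, x0, x1.
  exists 1, x1, x0; split; first exact: addrC.
  - by rewrite -[1]add0r.
  - by rewrite addr11_Z2.
  - by apply: contra L1x => L1x1; apply: memvD.
have [z0 [z1 [Lz0 Lz1 ->]]] := grade_decomp a z.
case/(center_grade Lz0 Lz1) => Zz0 Zz1.
(* The functional has to vanish on the grade a + 1 as well as on L^1. If x were w + g in this sum,
   then xa + (xb - g) = w would be in L^1, and so would its component xa. *)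
have xNU : xa + xb \notin (lower_central L 1 + grade L (a + 1)%R)%VS.
  apply: contra L1xa => /memv_addP[w L1w [g Lg Dx]].
  apply: (derived_grade Lxa (memvB Lxb Lg)).
  by rewrite addrA Dx addrK.
have [f [f_lin fx f0]] := exists_scalar_annihilating xNU.
have f_br u v : f (bracket L u v) = 0.
  by apply: f0; apply/(subvP (addvSl _ _))/memv_bracket; apply: memvf.
(* As f is zero on the grade a + 1, a vector y of degree a + c yields a map of degree c. *)
have homf c y : y \in grade L (a + c) -> in_center y ->
    exists D : 'End(L), homogeneous_superderivation c D
      /\ forall u, D u = f u *: y.
  move=> Ly Zy.
  have g_lin : linear (fun u : L => f u *: y).
    by move=> k u v; rewrite f_lin scalerDl scalerA.
  pose g : {linear L -> L} := HB.pack (fun u : L => f u *: y)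
    (GRing.isLinear.Build F L L *:%R (fun u : L => f u *: y) g_lin).
  have gE u : linfun g u = f u *: y by rewrite lfunE.
  exists (linfun g); split=> //; split=> [b u Lu | b u v Lu]; rewrite !gE.
    have [Db | Db] : b = a \/ b = a + 1.
    - case: (Z2P a) (Z2P b) => -> [] ->; rewrite ?add0r;
        by [left | right | right; apply: val_inj].
    - by rewrite Db memvZ // addrC.
    by rewrite f0 ?scale0r ?mem0v // -Db (subvP (addvSr _ _) _ Lu).
  rewrite f_br scale0r linearZl_LR linearZr_LR /= Zy center_right //.
  by rewrite !scaler0 addr0.
have [D0 [dD0 D0E]] : exists D : 'End(L), homogeneous_superderivation 0 D
    /\ forall u, D u = f u *: z0 by apply: homf; rewrite ?addr0.
have [D1 [dD1 D1E]] := homf 1 z1 Lz1 Zz1.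
exists (D0 + D1); split; first by exists D0, D1.
by rewrite lfunE /= D0E D1E fx !scale1r.
Qed.

End Superderivations.

Theorem theorem4p3 (F : fieldType) (L : lieSuperalgebra F)
    (L_nil3 : step_nilpotent L 3) :
  (exists D : 'End(L),
     [/\ superderivation D, ~ trivial_superderivation D
       & forall x : L, x \in lower_central L 1 -> in_center (D x)])
  /\ (exists Delta : 'End(L), pure_local_superderivation Delta).
Proof.
case: L_nil3 => _ L3_0 Lneq0.
have ZL2 z : z \in lower_central L 2 -> in_center z.
  move=> L2z; apply: right_center => y; apply/eqP; rewrite -memv0 -L3_0.
  exact: memv_bracket (memvf y) L2z.
have [a [w [L1w aw_neq0]]] :
    exists a w, w \in lower_central L 1 /\ bracket L a w != 0.
  (* These brackets of basis vectors span L^2 by definition, so they cannot all be 0. *)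
  set s := [seq bracket L u v | u <- vbasis fullv,
                                v <- vbasis (lower_central L 1)].
  have [/allP s0 | /allPn[_ /allpairsP[[u v] /= [_ Lv ->]] uv_neq0]] :=
      boolP (all (pred1 0) s).
    case: (Lneq0 2) => //; apply/eqP; rewrite -subv0.
    by apply/span_subvP=> x /s0 /eqP->; apply: mem0v.
  by exists u, v; split; first exact: vbasis_mem.
have adL1 x y : y \in lower_central L 1 -> in_center (ad x y).
  by move=> L1y; rewrite lfunE; apply/ZL2/memv_bracket; rewrite ?memvf.
split.
  exists (ad a); split; [exact: superderivation_ad | | exact: adL1].
  by move/(_ w); rewrite lfunE /= => /eqP; apply/negP.
(* The kernel of [projv] is the chosen complement of L^1. All values of [Delta] lie in [a, L^1],
   hence are central. *)
pose Delta := (ad a \o projv (lower_central L 1))%VF.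
have ZDelta x : in_center (Delta x) by rewrite lfunE; apply/adL1/memv_proj.
exists Delta; split=> [x | dDelta].
  have [L1x | L1x] := boolP (x \in lower_central L 1).
    exists (ad a); split; first exact: superderivation_ad.
    by rewrite lfunE /= projv_id.
  have [D [dD Dx]] := superderivation_interpolate L1x (ZDelta x).
  by exists D.
move/eqP: (superderivation_central dDelta ZDelta L1w).
by rewrite lfunE /= projv_id // lfunE; apply/negP.
Qed.
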